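(* Let $n\ge 3$ and let $H_n$ be the helm graph. Then $cn_{\chi}(H_n)=n+1$ and $$cn^c_{\chi}(H_n)=\begin{cases}\frac{n^3+n^2}{4}, & n \text{ even},\\ \frac{(n-1)^2(n+1)}{4}, & n\text{ odd}.\end{cases}$$
   Context: All graphs are finite, simple, undirected and connected. A chromatic colouring of a graph $G$ is a proper vertex colouring with exactly $\chi(G)$ colours $c_1,\ldots,c_\ell$, $\ell=\chi(G)$; the colour class of $c_i$ is denoted $\mathcal{C}_i$ and $\theta(c_i)=|\mathcal{C}_i|$. A $\chi^-$-colouring of $G$ is a chromatic colouring in which the maximum possible number of vertices gets colour $c_1$, then (subject to that) the maximum possible number of the remaining vertices gets $c_2$, then the maximum possible number of the remaining vertices gets $c_3$, and so on; that is, $(\theta(c_1),\ldots,\theta(c_\ell))$ is lexicographically maximal among all chromatic colourings of $G$. With respect to a $\chi^-$-colouring, the chromatic curling number is $cn_{\chi}(G)=\max\{\theta(c_i):1\le i\le \ell\}$ and the chromatic compound curling number is $cn^c_{\chi}(G)=\prod_{i=1}^{\ell}\theta(c_i)$. The helm graph $H_n$ (on $2n+1$ vertices) is obtained from the wheel consisting of a rim cycle $C_n$ and a central vertex adjacent to all rim vertices, by attaching one pendant edge to every vertex of the rim. *)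

(* Defs.v *)
From HB Require Import structures.
From mathcomp Require Import all_boot all_order all_algebra.

Set Implicit Arguments.
Unset Strict Implicit.
Unset Printing Implicit Defensive.

Import Order.TTheory GRing.Theory Num.Theory.

Record graph := Graph {
  vertex :> finType;
  edge : rel vertex;
  edge_sym : symmetric edge;
  edge_irr : irreflexive edge;
  edge_conn : forall x y, connect edge x y
}.

Definition proper (G : graph) k (c : {ffun G -> 'I_k}) : bool :=
  [forall x, forall y, edge x y ==> (c x != c y)].

Definition colorable (G : graph) k : bool :=
  [exists c : {ffun G -> 'I_k}, proper c].

Lemma colorable_ex (G : graph) : exists k, colorable G k.
Proof.
exists #|G|; apply/existsP; exists [ffun x => enum_rank x].
apply/forallP => x; apply/forallP => y; apply/implyP => xy.
by rewrite !ffunE (inj_eq enum_rank_inj); apply: contraTneq xy => ->;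
  rewrite edge_irr.
Qed.

Definition chi (G : graph) : nat := ex_minn (colorable_ex G).

Definition chromatic (G : graph) (c : {ffun G -> 'I_(chi G)}) : bool :=
  proper c && [forall i, i \in codom c].

Definition theta (G : graph) k (c : {ffun G -> 'I_k}) (i : 'I_k) : nat :=
  #|[set x | c x == i]|.

(* [seqlexi nat] carries the lexicographic order on sequences. *)
Definition thetas (G : graph) k (c : {ffun G -> 'I_k}) : seqlexi nat :=
  [seq theta c i | i <- enum 'I_k].

Definition chi_minus (G : graph) (c : {ffun G -> 'I_(chi G)}) : bool :=
  chromatic c &&
  [forall c' : {ffun G -> 'I_(chi G)},
     chromatic c' ==> (thetas c' <= thetas c)%O].

Lemma chromatic_ex (G : graph) : exists c : {ffun G -> 'I_(chi G)}, chromatic c.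
Proof.
rewrite /chromatic /chi; case: ex_minnP => k /existsP[c pc] kmin.
exists c; rewrite pc /=; apply/forallP => i; apply/negPn/negP => iNc.
have cN x : i != c x by apply: contraNneq iNc => ->; apply: codom_f.
case: k => [|k] in c pc kmin i iNc cN *; first by case: i {iNc cN}.
suff : colorable G k by move/kmin; rewrite ltnn.
apply/existsP; exists [ffun x => sval (unlift_some (cN x))].
apply/forallP => x; apply/forallP => y; apply/implyP => xy; rewrite !ffunE.
move/forallP/(_ x)/forallP/(_ y)/implyP/(_ xy): pc; apply: contraNneq => e.
case: (unlift_some (cN x)) e => u /= ux _; case: (unlift_some (cN y)) => v /= vy _ uv.
by rewrite ux vy uv.
Qed.

Lemma chi_minus_ex (G : graph) : exists c : {ffun G -> 'I_(chi G)}, chi_minus c.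
Proof.
have [c0 c0P] := chromatic_ex G.
case: (@arg_maxP _ _ _ c0 (@chromatic G) (@thetas G (chi G)) c0P) => c cP cmax.
by exists c; apply/andP; split=> //; apply/forallP => c'; apply/implyP/cmax.
Qed.

Definition curling (G : graph) k (c : {ffun G -> 'I_k}) : nat :=
  \max_i theta c i.

Definition compound_curling (G : graph) k (c : {ffun G -> 'I_k}) : nat :=
  \prod_i theta c i.

Definition cn_chi (G : graph) : nat := curling (xchoose (chi_minus_ex G)).

Definition cnc_chi (G : graph) : nat :=
  compound_curling (xchoose (chi_minus_ex G)).

(* The curling numbers do not depend on the chosen colouring. *)
Lemma chi_minus_theta (G : graph) (c c' : {ffun G -> 'I_(chi G)}) :
  chi_minus c -> chi_minus c' -> theta c =1 theta c'.
Proof.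
move=> /andP[cP /forallP cmax] /andP[c'P /forallP c'max].
have e : thetas c = thetas c'.
  by apply: le_anti; rewrite (implyP (c'max c) cP) (implyP (cmax c') c'P).
by move=> i; have /eq_in_map/(_ i (mem_enum _ i)) := e.
Qed.

Lemma cn_chiE (G : graph) (c : {ffun G -> 'I_(chi G)}) :
  chi_minus c -> cn_chi G = curling c.
Proof.
move=> cP; apply: eq_bigr => i _.
exact: chi_minus_theta (xchooseP (chi_minus_ex G)) cP i.
Qed.

Lemma cnc_chiE (G : graph) (c : {ffun G -> 'I_(chi G)}) :
  chi_minus c -> cnc_chi G = compound_curling c.
Proof.
move=> cP; apply: eq_bigr => i _.
exact: chi_minus_theta (xchooseP (chi_minus_ex G)) cP i.
Qed.

(* [None] is the centre, [inl i] the rim vertex [i], and [inr i] the pendant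
   vertex attached to it. The test [i != j] matters only for [n = 1], where
   [ordS] has a fixed point. *)
Definition helm_edge n : rel (option ('I_n + 'I_n)) := fun x y =>
  match x, y with
  | None, Some (inl _) | Some (inl _), None => true
  | Some (inl i), Some (inl j) => (i != j) && ((j == ordS i) || (i == ordS j))
  | Some (inl i), Some (inr j) | Some (inr i), Some (inl j) => i == j
  | _, _ => false
  end.

Lemma helm_sym n : symmetric (@helm_edge n).
Proof.
move=> [[i|i]|] [[j|j]|] //=; try exact: eq_sym.
by rewrite eq_sym orbC.
Qed.

Lemma helm_irr n : irreflexive (@helm_edge n).
Proof. by move=> [[i|i]|] //=; rewrite eqxx. Qed.

Lemma helm_conn n x y : connect (@helm_edge n) x y.
Proof.
suff centre z : connect (@helm_edge n) None z.
  by apply: (connect_trans _ (centre y)); rewrite (sym_connect_sym (@helm_sym n)).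
have rim i : connect (@helm_edge n) None (Some (inl i)) by apply: connect1.
case: z => [[i|i]|]; [exact: rim| |exact: connect0].
by apply: connect_trans (rim i) (connect1 _); rewrite /= eqxx.
Qed.

Definition helm n : graph :=
  Graph (@helm_sym n) (@helm_irr n) (@helm_conn n).

(* Main.v *)
Require Import Defs.
From mathcomp Require Import all_boot all_order all_algebra.
From mathcomp Require Import zify ring.
Import Order.TTheory GRing.Theory Num.Theory.

(** A rim vertex and its pendant never share a colour, so a colour class has at
    most [n + 1] vertices, with equality only for the centre together with all
    the pendants. Once that class is removed, the other colours partition the
    rim cycle into independent sets, each of size at most [n./2]; the
    lexicographically largest sizes are therefore [n./2, n./2], followed by [1]
    when [n] is odd. *)

(** * Counting the vertices of a colour class *)

Lemma sum_helm n (F : helm n -> nat) :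
  \sum_x F x =
    F None + (\sum_j F (Some (inl j)) + \sum_j F (Some (inr j))).
Proof.
rewrite (bigD1 None) //=; congr (_ + _).
rewrite (reindex_omap Some id) /=; last by case.
rewrite -(big_sumType _ xpredT (fun x => F (Some x))) /=.
by apply: eq_bigl => x; rewrite eqxx.
Qed.

Lemma properP {G : graph} {k} {c : {ffun G -> 'I_k}} :
  reflect (forall x y, edge x y -> c x != c y) (Defs.proper c).
Proof.
apply: (iffP forallP) => [h x y xy|h x].
  by have /forallP/(_ y)/implyP := h x; apply.
by apply/forallP => y; apply/implyP/h.
Qed.

(** Counts are sums of booleans over the rim index, so that two of them can be added and bounded
    term by term. *)
Definition rim_class {n k} (c : {ffun helm n -> 'I_k}) (i : 'I_k) : nat :=
  \sum_j (c (Some (inl j)) == i).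

Definition pendant_class {n k} (c : {ffun helm n -> 'I_k}) (i : 'I_k) : nat :=
  \sum_j (c (Some (inr j)) == i).

Lemma theta_helm n k (c : {ffun helm n -> 'I_k}) i :
  theta c i = (c None == i) + (rim_class c i + pendant_class c i).
Proof.
by rewrite -(sum_helm n (fun x => c x == i : nat)) /theta -sum1dep_card
  big_mkcond /=; apply: eq_bigr => x _; case: eqP.
Qed.

Lemma sum_theta (G : graph) k (c : {ffun G -> 'I_k}) : \sum_i theta c i = #|G|.
Proof.
rewrite -sum1_card (partition_big c predT) //=; apply: eq_bigr => i _.
by rewrite /theta -sum1dep_card.
Qed.

Lemma card_helm n : #|helm n| = n.*2.+1.
Proof. by rewrite /= card_option card_sum card_ord addnn. Qed.

Lemma sum_rim_class {n k} (c : {ffun helm n -> 'I_k}) : \sum_i rim_class c i = n.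
Proof.
rewrite exchange_big /= -[RHS]card_ord -sum1_card; apply: eq_bigr => j _.
by rewrite (bigD1 (c (Some (inl j)))) //= eqxx big1 // => i /negbTE;
  rewrite eq_sym => ->.
Qed.

Lemma ordS_neq n (j : 'I_n) : 1 < n -> j != ordS j.
Proof.
move=> n_gt1; rewrite -val_eqE /=; have := ltn_ord j.
rewrite leq_eqVlt => /orP[/eqP e|lt_j]; last by rewrite modn_small ?neq_ltn ?ltnSn.
by rewrite e modnn; lia.
Qed.

(** * Bounds valid for every proper colouring *)

Section ProperColouring.

Variables (n k : nat) (c : {ffun helm n -> 'I_k}).
Hypothesis c_proper : Defs.proper c.

Lemma rim_class_centre : rim_class c (c None) = 0.
Proof.
apply: big1 => j _; have /properP/(_ (Some (inl j)) None isT) := c_proper.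
by case: eqP.
Qed.

(* The class and its successor along the cycle are disjoint. *)
Lemma double_rim_class i : 1 < n -> (rim_class c i).*2 <= n.
Proof.
move=> n_gt1; rewrite -addnn {2}/rim_class (reindex_inj (@ordS_inj n)) /=.
rewrite -big_split /= -[leqRHS]card_ord -sum1_card; apply: leq_sum => j _.
have /properP/(_ (Some (inl j)) (Some (inl (ordS j)))) := c_proper.
rewrite /= ordS_neq // eqxx => /(_ isT).
by case: (c (Some (inl j)) =P i) => [->|_ _];
  [rewrite eq_sym => /negbTE->|exact: leq_b1].
Qed.

Lemma rim_pendant_class i : rim_class c i + pendant_class c i <= n.
Proof.
rewrite -big_split /= -[leqRHS]card_ord -sum1_card; apply: leq_sum => j _.
have /properP/(_ (Some (inl j)) (Some (inr j))) := c_proper.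
rewrite /= eqxx => /(_ isT).
by case: (c (Some (inl j)) =P i) => [->|_ _];
  [rewrite eq_sym => /negbTE->|exact: leq_b1].
Qed.

Lemma theta_helm_le i : theta c i <= n.+1.
Proof.
rewrite theta_helm; apply: (@leq_add _ _ 1); first exact: leq_b1.
exact: rim_pendant_class.
Qed.

Lemma theta_helm_centre i : theta c i = n.+1 -> c None = i.
Proof.
rewrite theta_helm => e; have := rim_pendant_class i.
by move: e; case: eqP => // _; rewrite add0n => ->; rewrite ltnn.
Qed.

(** A class of size [n.+1] holds the centre, hence no rim vertex, hence all [n] pendants. Any other
    class then lies inside the rim, where independence gives the bound. *)
Lemma theta_helm_half i j :
  1 < n -> theta c i = n.+1 -> j != i -> theta c j <= n./2.
Proof.
move=> n_gt1 i_max ji; have ci := theta_helm_centre _ i_max.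
have pend : pendant_class c i + pendant_class c j <= n.
  rewrite -big_split /= -[leqRHS]card_ord -sum1_card; apply: leq_sum => x _.
  by case: eqP => [->|_]; rewrite ?leq_b1 // eq_sym (negbTE ji).
have := double_rim_class j n_gt1; move: i_max pend rim_class_centre.
by rewrite !theta_helm ci eqxx [i == j]eq_sym (negbTE ji); lia.
Qed.

(** The centre's colour is absent from the rim, so [k.-1] independent sets of size at most [n./2]
    cover [n] vertices. One is too few, and for odd [n] so are two, which cover at most [n - 1]. *)
Lemma helm_colours_ge : 1 < n -> (odd n).+3 <= k.
Proof.
move=> n_gt1; have : n <= k.-1 * n./2.
  rewrite -{1}(sum_rim_class c) (bigD1 (c None)) //= rim_class_centre add0n.
  apply: (@leq_trans (\sum_(i | i != c None) n./2)).
    by apply: leq_sum => i _; have := double_rim_class i n_gt1; lia.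
  by rewrite sum_nat_const cardC1 card_ord.
have : 0 < k by apply: leq_ltn_trans (ltn_ord (c None)).
have := odd_double_half n.
case: k => [|[|[|[|k']]]] //=; case: (odd n) => //=; lia.
Qed.

Lemma thetas_behead :
  1 < n -> head 0 (thetas c) = n.+1 -> all (leq^~ n./2) (behead (thetas c)).
Proof.
move=> n_gt1; rewrite /thetas.
have := enum_uniq 'I_k; case: (enum 'I_k) => //= i r /andP[ir _] i_max.
apply/allP => _ /mapP[j jr ->]; apply: theta_helm_half i_max _ => //.
by apply: contraNneq ir => <-.
Qed.

Lemma sumn_thetas : sumn (thetas c) = n.*2.+1.
Proof. by rewrite sumnE big_map big_enum sum_theta card_helm. Qed.

End ProperColouring.

(** The boolean [odd n] is read as 0 or 1, so the fourth entry exists only for odd [n]. *)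
Definition helm_sizes n : seqlexi nat :=
  [:: n.+1, n./2, n./2 & nseq (odd n) 1].

(** * Arithmetic and lexicographic comparison of lists of class sizes *)

Section Sizes.

Variables (n : nat) (s : seq nat).
Hypothesis size_s : size s = (odd n).+3.
Hypothesis sum_s : sumn s = n.*2.+1.
Hypothesis s_behead : head 0 s = n.+1 -> all (leq^~ n./2) (behead s).

(** The entries after the first add up to [n], which is also the sum of their upper bounds, so every
    bound is attained. For even [n] the condition on the fourth entry is void, as [nth] returns its
    default 0. *)
Lemma helm_sizes_eq : head 0 s = n.+1 -> nth 0 s 3 <= 1 -> s = helm_sizes n.
Proof.
move=> s0 s3; move: (s_behead s0) size_s sum_s (s0) s3 (odd_double_half n).
rewrite /helm_sizes; case: (odd n) => /=;
  case: s => [|a [|b [|d [|e [|f r]]]]] //=.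
- move=> /and4P[? ? ? _] _ ? ? ? ?; suff [-> -> -> ->] :
    [/\ a = n.+1, b = n./2, d = n./2 & e = 1] by [].
  by split; lia.
- move=> /and3P[? ? _] _ ? ? ? ?; suff [-> -> ->] :
    [/\ a = n.+1, b = n./2 & d = n./2] by [].
  by split; lia.
Qed.

Lemma helm_sizes_max :
  head 0 s <= n.+1 -> (helm_sizes n <= (s : seqlexi nat))%O -> s = helm_sizes n.
Proof.
move=> s0_le s_ge; have s0 : head 0 s = n.+1.
  case: s s0_le s_ge => [|a r] //= a_le; rewrite lexi_cons => /andP[+ _].
  by rewrite leEnat => ?; apply/eqP; rewrite eqn_leq a_le.
apply: helm_sizes_eq (s0) _.
move: (s_behead s0) size_s sum_s (s0) s_ge (odd_double_half n).
rewrite /helm_sizes; case: (odd n) => /=;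
  case: s => [|a [|b [|d [|e [|f r]]]]] //=.
(* Only odd [n] is left. The upper bounds on the entries are the premises under which the
   lexicographic order passes to the next entry, so the second and third equal [n./2] and the sum
   leaves 1 for the fourth. *)
rewrite !lexi_cons !leEnat => /and4P[b_le d_le _ _] _ sum_eq a_eq.
by rewrite a_eq leqnn b_le d_le /= => /and3P[? ? _] ?; lia.
Qed.

End Sizes.

(** * An explicit optimal colouring and the chromatic number *)

Section OptimalColouring.

Variable n : nat.
Hypothesis n_ge3 : 3 <= n.

(* On an odd cycle the last vertex gets the extra colour [3]. *)
Definition helm_colour (x : helm n) : nat :=
  if x is Some (inl j) then
    if odd n && (j.+1 == n) then 3 else (odd j).+1
  else 0.

Lemma helm_colour_lt x : helm_colour x < (odd n).+3.
Proof.
by case: x => [[j|j]|] //=; case: (odd n); case: (odd j); case: (_ == n).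
Qed.

Definition helm_colouring : {ffun helm n -> 'I_(odd n).+3} :=
  [ffun x => inord (helm_colour x)].

Lemma helm_colouringE x : helm_colouring x = helm_colour x :> nat.
Proof. by rewrite ffunE inordK ?helm_colour_lt. Qed.

Lemma helm_colour_ordS j :
  helm_colour (Some (inl j)) != helm_colour (Some (inl (ordS j))).
Proof.
rewrite /=; have := ltn_ord j; rewrite leq_eqVlt => /orP[/eqP e|lt_j].
  (* Wrap-around to vertex 0, of colour 1. The last vertex has colour 3 if [n] is odd, and colour 2
     if [n] is even, its index [n - 1] being odd. *)
  rewrite e modnn eqxx /=.
  have -> : (1 == n) = false by lia.
  by rewrite andbF andbT; case: ifP => //; move: e; lia.
rewrite modn_small // [_.+1 == n]ltn_eqF // andbF /=.
by case: ifP => _; case: (odd j).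
Qed.

Lemma helm_colouring_proper : Defs.proper helm_colouring.
Proof.
apply/properP => x y xy; rewrite -val_eqE /= !helm_colouringE.
case: x y xy => [[i|i]|] [[j|j]|] //= => [/andP[_ /orP[]/eqP->]|_|_|_|_].
- exact: helm_colour_ordS.
- by rewrite eq_sym; apply: helm_colour_ordS.
- by case: ifP.
- by case: ifP.
- by case: ifP.
- by case: ifP.
Qed.

Lemma head_thetas k (G : graph) (c : {ffun G -> 'I_k.+1}) :
  head 0 (thetas c) = theta c ord0.
Proof. by rewrite /thetas enum_ordSl. Qed.

Lemma thetas_helm_colouring : thetas helm_colouring = helm_sizes n.
Proof.
have n_gt1 : 1 < n by apply: leq_trans n_ge3.
have cP := helm_colouring_proper.
apply: helm_sizes_eq.
- by rewrite size_map size_enum_ord.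
- exact: sumn_thetas.
- exact: thetas_behead.
(* Colour 0 is given to the centre and to all [n] pendants. *)
- rewrite head_thetas; apply/eqP; rewrite eqn_leq theta_helm_le //= theta_helm.
  rewrite -val_eqE /= helm_colouringE eqxx ltnS.
  apply: leq_trans (leq_addl _ _); rewrite -[leqLHS]card_ord -sum1_card.
  by apply: leq_sum => j _; rewrite -val_eqE /= helm_colouringE.
(* If there is a fourth colour, its class is contained in the singleton of the last rim vertex. *)
- case: (ltnP 3 (odd n).+3) => [h|h]; last first.
    by rewrite nth_default // size_map size_enum_ord.
  rewrite (nth_map ord0) ?size_enum_ord //.
  set i := nth _ _ _; have iE : i = 3 :> nat by rewrite nth_enum_ord.
  have last_lt : n.-1 < n by lia.
  suff sub : [set x | helm_colouring x == i] \subset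
      [set (Some (inl (Ordinal last_lt)) : helm n)].
    by apply: leq_trans (subset_leq_card sub) _; rewrite cards1.
  apply/subsetP => x; rewrite !inE -val_eqE /= helm_colouringE iE.
  case: x => [[j|j]|] //=; case: ifP => [/andP[_ /eqP e] _|]; last by case: (odd j).
  by apply/eqP; congr (Some (inl _)); apply: val_inj => /=; lia.
Qed.

(** No class is empty because [n./2] is positive; a chromatic colouring has to use every colour. *)
Lemma helm_colouring_onto i : i \in codom helm_colouring.
Proof.
have : theta helm_colouring i \in helm_sizes n.
  by rewrite -thetas_helm_colouring map_f ?mem_enum.
have : 0 \notin helm_sizes n.
  by rewrite !inE mem_nseq andbF orbF; lia.
case: (posnP (theta helm_colouring i)) => [-> /negP //|+ _ _].
by rewrite card_gt0 => /set0Pn[x]; rewrite inE => /eqP <-; apply: codom_f.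
Qed.

Lemma chi_helm : chi (helm n) = (odd n).+3.
Proof.
rewrite /chi; case: ex_minnP => k /existsP[c cP] k_min.
apply/eqP; rewrite eqn_leq (helm_colours_ge _ _ _ cP) ?andbT; last first.
  exact: leq_trans n_ge3.
apply: k_min; apply/existsP; exists helm_colouring.
exact: helm_colouring_proper.
Qed.

Lemma thetas_chi_minus (c : {ffun helm n -> 'I_(chi (helm n))}) :
  chi_minus c -> thetas c = helm_sizes n.
Proof.
rewrite /chi_minus /chromatic.
(* The type of [c] depends on [chi (helm n)], so this number is generalised before its value is
   substituted. *)
move: (chi _) chi_helm c => k -> c /andP[/andP[cP _] /forallP c_max].
have n_gt1 : 1 < n by apply: leq_trans n_ge3.
apply: helm_sizes_max.
- by rewrite size_map size_enum_ord.
- exact: sumn_thetas.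
- exact: thetas_behead.
- by rewrite head_thetas theta_helm_le.
- rewrite -thetas_helm_colouring; apply: (implyP (c_max _)).
  by rewrite helm_colouring_proper; apply/forallP/helm_colouring_onto.
Qed.

End OptimalColouring.

Theorem theorem4 (n : nat) (n_ge3 : (3 <= n)%N) :
  cn_chi (helm n) = n.+1 /\
  ((cnc_chi (helm n))%:R =
    if odd n then (n%:R - 1) ^+ 2 * (n%:R + 1) / 4
    else (n%:R ^+ 3 + n%:R ^+ 2) / 4 :> rat)%R.
Proof.
have [c c_opt] := chi_minus_ex (helm n).
have cE := thetas_chi_minus _ n_ge3 _ c_opt.
rewrite (cn_chiE c_opt) (cnc_chiE c_opt) /curling /compound_curling.
(* The maximum and the product over colours become folds over the list [thetas c], whose value is
   known. *)
rewrite -[X in X = _ /\ _]big_enum -[X in (X%:R)%R]big_enum /=.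
rewrite -!(big_map (theta c) xpredT id) -/(thetas c) cE /helm_sizes.
(* Writing [n] as [2 * m] or [2 * m + 1] removes the rounded half; in both cases the product is
   [(n + 1) * m ^ 2]. *)
have := odd_double_half n; set m := n./2.
case: (odd n) => /= nE; rewrite !big_cons !big_nil; split; try lia.
- by rewrite -nE -addnn !natrM !natrD /=; field.
- by rewrite -nE -addnn !natrM -natr1 !natrD /=; field.
Qed.
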